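(* For every integer $n$ for which $f(n,t_3(n)+1)$ is defined (i.e. $t_3(n)+1\le \binom n2$, equivalently $n\ge 4$), $$f(n,t_3(n)+1) = 3n-\left\lceil \frac{n}{3} \right\rceil - 4 .$$
   Context: All graphs are finite and simple. A graph is chordal if it contains no induced cycle of length at least $4$. Subgraphs are not required to be induced. For integers $n\ge 1$ and $0\le m\le \binom n2$, $f(n,m)$ denotes the maximum integer such that every graph with $n$ vertices and $m$ edges contains a chordal subgraph with at least $f(n,m)$ edges. $T_k(n)$ is the Turán graph, i.e. the complete $k$-partite graph on $n$ vertices with part sizes as equal as possible, and $t_k(n)$ is its number of edges. *)

(* Defs.v *)
From mathcomp Require Import all_boot.
From mathcomp Require Import boolp.

Set Implicit Arguments.
Unset Strict Implicit.
Unset Printing Implicit Defensive.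

Record graph (T : finType) := Graph {
  vset : {set T};
  eset : {set {set T}};
  edgeP : forall e, e \in eset -> e \subset vset /\ #|e| = 2 }.

Definition subgraph (T : finType) (H G : graph T) : Prop :=
  vset H \subset vset G /\ eset H \subset eset G.

Definition adj (T : finType) (G : graph T) : rel T :=
  fun x y => [set x; y] \in eset G.

(* The last clause says that c has no chord: an edge of G between two vertices
   of c joins cyclically consecutive vertices. *)
Definition induced_cycle (T : finType) (G : graph T) (c : seq T) : Prop :=
  [/\ uniq c, cycle (adj G) c
    & {in c &, forall x y, adj G x y -> y = next c x \/ x = next c y}].

Definition chordal (T : finType) (G : graph T) : Prop :=
  forall c : seq T, 4 <= size c -> ~ induced_cycle G c.

Definition chordal_guarantee (n m k : nat) : Prop :=
  forall (T : finType) (G : graph T), #|vset G| = n -> #|eset G| = m ->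
  exists H : graph T, [/\ subgraph H G, chordal H & k <= #|eset H|].

(* The range k <= m loses nothing when m <= 'C(n, 2), since a subgraph of a
   graph with m edges has at most m edges (see f_maximum).  For larger m the
   guarantee is vacuous and the value of f is meaningless. *)
Definition f (n m : nat) : nat :=
  \max_(k < m.+1 | `[< chordal_guarantee n m k >]) k.

(* The parts are the residue classes modulo k, whose sizes differ by at most
   one. *)
Definition turan_edges (k n : nat) : {set {set 'I_n}} :=
  [set [set x; y] | x in 'I_n, y in 'I_n & x != y %[mod k]].

Lemma turan_edgeP (k n : nat) (e : {set 'I_n}) :
  e \in turan_edges k n -> e \subset [set: 'I_n] /\ #|e| = 2.
Proof.
case/imset2P=> x y _; rewrite inE => /andP[_ xy] ->; split; first exact: subsetT.
by rewrite cards2 (_ : x != y) //; apply: contraNneq xy => ->.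
Qed.

Definition turan (k n : nat) : graph 'I_n := Graph (@turan_edgeP k n).

Definition t (k n : nat) : nat := #|eset (turan k n)|.

Lemma graph_exists (n m : nat) : m <= 'C(n, 2) ->
  exists G : graph 'I_n, #|vset G| = n /\ #|eset G| = m.
Proof.
rewrite -[n in 'C(n, _)]card_ord -card_draws => le_m.
have [E sE cE] : exists2 E : {set {set 'I_n}},
    E \subset [set e : {set 'I_n} | #|e| == 2] & #|E| = m.
  have := le_m; rewrite -bin_gt0 -cards_draws card_gt0 => /set0Pn[E].
  by rewrite inE => /andP[sE /eqP cE]; exists E.
have EP e : e \in E -> e \subset [set: 'I_n] /\ #|e| = 2.
  by move/(subsetP sE); rewrite inE => /eqP ->; rewrite subsetT.
by exists (Graph EP); rewrite cardsT card_ord.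
Qed.

Lemma f_maximum (n m : nat) : m <= 'C(n, 2) ->
  chordal_guarantee n m (f n m) /\
  (forall k, chordal_guarantee n m k -> k <= f n m).
Proof.
move=> le_m; split=> [|k gk].
  have g0 : chordal_guarantee n m 0.
    move=> T G _ _.
    have EP (e : {set T}) : e \in set0 -> e \subset set0 /\ #|e| = 2.
      by rewrite inE.
    exists (Graph EP); split=> //; first by split; rewrite sub0set.
    by move=> [|x [|y c]] //= _ [_ /=]; rewrite /adj inE.
  rewrite /f; elim/big_ind: _ => // [x y gx gy|i /asboolP //].
  by rewrite /maxn; case: ifP.
have [G [nG mG]] := graph_exists le_m.
have [H [[_ sH] _ kH]] := gk _ _ nG mG.
have km : k < m.+1 by rewrite ltnS -mG (leq_trans kH) ?subset_leq_card.
exact: (leq_bigmax_cond (Ordinal km) (asboolT gk)).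
Qed.

(* Main.v *)
Require Import Defs.
From mathcomp Require Import all_boot all_order all_algebra.
From mathcomp Require Import zify ring lra.
Import Order.TTheory GRing.Theory Num.Theory.

(* Upper bound: add to T_3(n) an edge xy inside a largest part, of size
   a = ceil(n/3). A chordal subgraph has at most n - a + 1 edges at x; deleting x
   leaves a tripartite chordal graph, in which any two parts induce a forest, so
   that it has at most 2(n - 1) - 3 edges.

   Lower bound: choose v_1, ..., v_4 greedily, each of maximum degree in the
   common neighbourhood of the previous ones, and let a_i be the number of
   non-neighbours of v_i (itself included). Grow a chordal graph from
   K = {v_1, ..., v_4} by joining each vertex u to S(u) = N(u) /\ K and, when
   possible, to one already added neighbour w with S(u) <= S(w); if no vertex can
   be so joined, add a vertex u with |S(u)| maximum, joined to S(u) only. This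
   yields 6 + sum |S(u)| + g edges, g being the number of vertices of the first
   kind. With q = a_1 + a_2 + a_3 + a_4 - n and c(u) = 4 - |S(u)|, every u should
   have at least (sum of the a_i with v_i not adjacent to u) - (c(u) - 1) q
   non-neighbours. The greedy choice gives this up to an error bounded by a
   constant for the vertices of the first kind. For the other ones the error is at
   most the number of neighbours w of u with S(u) <= S(w); these are of the first
   kind and belong to only one u, so that the total error is controlled by g.
   Summing over u bounds n^2 - 2m from below by sum a_i^2 - q^2 minus this
   error, which contradicts 3m > n^2 if the chordal graph is too small. *)

(** * Growing chordal subgraphs *)

Lemma sum_mem {T : finType} (A : {set T}) (P : pred T) :
  \sum_(x in A) (P x : nat) = #|[set x in A | P x]|.
Proof.
rewrite -sum1_card big_mkcond [RHS]big_mkcond; apply: eq_bigr => x _.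
by rewrite inE; case: (x \in A); case: (P x).
Qed.

(** * Neighbourhoods and simplicial vertices *)

Section Graph.
Context {T : finType}.
Implicit Types (G H : graph T) (x y u w : T) (K Q X R : {set T}).

Definition nbr G x : {set T} := [set y | adj G x y].

Lemma adjC G x y : adj G x y = adj G y x.
Proof. by rewrite /adj setUC. Qed.

Lemma adj_neq G x y : adj G x y -> x != y.
Proof. by case/edgeP=> _; rewrite cards2; case: eqP. Qed.

Lemma adjxx G x : adj G x x = false.
Proof. by apply/negP=> /adj_neq; rewrite eqxx. Qed.

Lemma adj_vset G x y : adj G x y -> x \in vset G.
Proof. by case/edgeP=> /subsetP/(_ x) + _; apply; rewrite set21. Qed.

Lemma nbr_sub G x : nbr G x \subset vset G.
Proof. by apply/subsetP=> y; rewrite inE adjC; apply: adj_vset. Qed.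

Lemma edge_adj G e x : e \in eset G -> x \in e ->
  exists2 y, adj G x y & e = [set x; y].
Proof.
move=> eE xe; have [_ /eqP/cards2P[a [b [_ e_ab]]]] := edgeP eE.
move: xe; rewrite e_ab !inE => /orP[]/eqP->.
  by exists b; rewrite ?/adj -?e_ab.
by exists a; rewrite ?/adj setUC -?e_ab.
Qed.

Lemma card_nbr G x : #|nbr G x| = #|[set e in eset G | x \in e]|.
Proof.
rewrite -(@card_in_imset _ _ (fun y => [set x; y]) (mem (nbr G x))).
  apply: eq_card => e; rewrite !inE; apply/imsetP/andP => [[y yx ->]|[eE xe]].
    by move: yx; rewrite inE set21.
  by have [y xy ->] := edge_adj G e x eE xe; exists y; rewrite // inE.
move=> y z; rewrite !inE => /adj_neq xy _ /setP/(_ y).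
by rewrite !inE eqxx orbT eq_sym (negPf xy) => /esym/eqP.
Qed.

Lemma handshake G : \sum_(x in vset G) #|nbr G x| = 2 * #|eset G|.
Proof.
transitivity (\sum_(x in vset G) \sum_(e in eset G) (x \in e)).
  apply: eq_bigr => x _; rewrite card_nbr sum_mem.
  by apply: eq_card => e; rewrite !inE.
rewrite exchange_big /= mulnC -sum_nat_const; apply: eq_bigr => e /edgeP[eV e2].
rewrite sum_mem -e2; apply: eq_card => x; rewrite !inE andbC.
by case: (boolP (x \in e)) => [/(subsetP eV)|].
Qed.

(* The two cyclic neighbours of [u] in a cycle through [u] both lie in the
   clique [Q], so they form a chord as soon as the cycle has length at least 4. *)
Lemma add_simplicial G H u Q : subgraph H G -> chordal H -> Q \subset nbr G u ->
    (forall x, ~~ adj H u x) ->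
    {in Q &, forall x y, x != y -> adj H x y} ->
  exists H', [/\ subgraph H' G, chordal H', #|eset H'| = #|eset H| + #|Q|
    & forall x y, adj H' x y =
        [|| adj H x y, (x == u) && (y \in Q) | (y == u) && (x \in Q)]].
Proof.
move=> [vHG eHG] chH QN u0 Qcl.
have uQ : u \notin Q by apply/negP=> /(subsetP QN); rewrite inE adjxx.
pose E := eset H :|: [set [set u; y] | y in Q].
have EG e : e \in E -> e \in eset G.
  rewrite inE => /orP[/(subsetP eHG) //|/imsetP[y /(subsetP QN)]].
  by rewrite inE => uy ->.
have EP e : e \in E -> e \subset vset G /\ #|e| = 2 by move/EG/edgeP.
pose H' := Graph EP.
have adjE x y : adj H' x y =
    [|| adj H x y, (x == u) && (y \in Q) | (y == u) && (x \in Q)].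
  rewrite /adj inE; congr (_ || _); apply/imsetP/idP => [[z zQ xy]|].
    have zu : z != u by apply: contraNneq uQ => <-.
    have := adj_neq H' x y; rewrite /adj inE.
    have -> : [set x; y] \in [set [set u; y] | y in Q] by apply/imsetP; exists z.
    rewrite orbT => /(_ isT) nxy.
    have := set21 x y; have := set22 x y; rewrite xy !inE.
    case/orP=> /eqP yE; case/orP=> /eqP xE; rewrite yE xE ?eqxx ?zQ ?orbT //.
    - by rewrite yE xE eqxx in nxy.
    - by rewrite yE xE eqxx in nxy.
  by case/orP=> /andP[/eqP-> ?]; [exists y|exists x; rewrite // setUC].
exists H'; split=> //; first by split=> //; apply/subsetP=> e /EG.
- move=> c sc [uc cc ic].
  have [uinc|unc] := boolP (u \in c); last first.
    have ne x : x \in c -> x != u by move=> xc; apply: contraNneq unc => <-.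
    have eq_adj : {in c &, forall x y, adj H' x y = adj H x y}.
      by move=> x y xc yc; rewrite adjE (negPf (ne x xc)) (negPf (ne y yc)) !orbF.
    apply: (chH c sc); split=> //.
      by rewrite -(eq_in_cycle (P := mem c) eq_adj) //; apply/allP.
    by move=> x y xc yc; rewrite -eq_adj //; apply: ic.
  have [i d cE] := rot_to uinc.
  have ud : uniq (u :: d) by rewrite -cE rot_uniq.
  have sd : 3 <= size d by move: sc; rewrite -(size_rot i) cE.
  have cd : cycle (adj H') (u :: d) by rewrite -cE rot_cycle.
  have id_ x y : x \in u :: d -> y \in u :: d -> adj H' x y ->
      y = next (u :: d) x \/ x = next (u :: d) y.
    by rewrite -cE !mem_rot !next_rot //; apply: ic.
  case: d sd ud cd id_ {cE} => // x d; case/lastP: d => // d z.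
  rewrite /= size_rcons ltnS => sd ud cd id_.
  have uxQ : x \in Q.
    move: cd => /andP[+ _]; rewrite adjE (negPf (u0 x)) eqxx (negPf uQ) andbF.
    by rewrite orbF.
  have zQ : z \in Q.
    move: cd => /andP[_]; rewrite rcons_path last_rcons => /andP[_].
    by rewrite adjE eqxx (negPf uQ) andbF adjC (negPf (u0 z)).
  have xz : x != z.
    by move: ud; rewrite mem_rcons inE; case: (x == z); rewrite ?andbF.
  have xzA : adj H' x z by rewrite adjE Qcl.
  have xu : x != u by apply: contraNneq uQ => <-.
  have zu : z != u by apply: contraNneq uQ => <-.
  have := id_ x z; rewrite !inE !mem_rcons !inE !eqxx !orbT => /(_ isT isT xzA).
  case=> [zE|xE].
    case: d sd ud zE {id_ cd} => // y d _ /=.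
    rewrite (negPf xu) eqxx => ud zy.
    by move: ud => /= /and4P[_ _ /negP[]]; rewrite -zy mem_rcons mem_head.
  have : next (u :: x :: rcons d z) z = u.
    by rewrite -[_ :: _]/(rcons (u :: x :: d) z) -(next_rotr 1) ?rotr1_rcons //= eqxx.
  by move=> nz; move: xu; rewrite (etrans xE nz) eqxx.
- rewrite cardsU (_ : _ :&: _ = set0) ?cards0 ?subn0.
    rewrite card_in_imset // => y z yQ _ /setP/(_ y).
    rewrite !inE eqxx orbT; case: eqP => [yu|_ /esym/eqP //].
    by rewrite -yu yQ in uQ.
  apply/setP=> e; rewrite !inE; apply/negP=> /andP[eH /imsetP[y _ eE]].
  by move: (u0 y); rewrite /adj -eE eH.
Qed.
End Graph.

(** * The growing process *)

Section Grow.
Context {T : finType}.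
Implicit Types (G H : graph T) (x y u w : T) (K Q X R : {set T}).

Lemma clique_chordal G K : K \subset vset G ->
    {in K &, forall x y, x != y -> adj G x y} ->
  exists H, [/\ subgraph H G, chordal H, #|eset H| = 'C(#|K|, 2)
    & forall x y, adj H x y = [&& x \in K, y \in K & x != y]].
Proof.
move=> KV Kcl; pose E := [set e : {set T} | (e \subset K) && (#|e| == 2)].
have EP e : e \in E -> e \subset vset G /\ #|e| = 2.
  by rewrite inE => /andP[eK /eqP->]; split=> //; apply: subset_trans KV.
have adjE x y : adj (Graph EP) x y = [&& x \in K, y \in K & x != y].
  by rewrite /adj inE subUset !sub1set cards2 -andbA; case: (x != y).
exists (Graph EP); split=> //.
- split=> //; apply/subsetP=> e eE; have [_ /eqP/cards2P[x [y [xy eE']]]] := EP e eE.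
  move: (adjE x y); rewrite {1}/adj /= -eE' eE => /esym/and3P[xK yK _].
  by rewrite eE'; apply: Kcl.
- move=> [|x [|y [|z [|t c]]]] //= _ [uc cc ic].
  have [xK zK] : x \in K /\ z \in K.
    by move: cc; rewrite /= !adjE => /and4P[/and3P[-> _ _] _ /and3P[-> _ _] _].
  move: uc; rewrite /= !inE !negb_or.
  case/and5P=> /and4P[xy xz xt _] /and3P[yz yt _] _ _ _.
  case: (ic x z); rewrite ?inE ?eqxx ?orbT ?adjE ?xK ?zK //=.
    by rewrite eqxx => zy; rewrite zy eqxx in yz.
  by rewrite ![z == _]eq_sym (negPf xz) (negPf yz) eqxx => xt'; rewrite xt' eqxx in xt.
- rewrite -cards_draws; apply: eq_card => e; by rewrite !inE.
Qed.

(* If [u] is joined to [nbr G u :&: K] only, each of these vertices can later be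
   joined to [u] in addition to its neighbours in [K]. *)
Definition dominating G K u := [set w in nbr G u | nbr G u :&: K \subset nbr G w].

Definition pending G K X :=
  [set w in vset G :\: X |
    [exists x in X :\: K, adj G w x && (nbr G w :&: K \subset nbr G x)]].

(* [H] is being built vertex by vertex and currently spans [X]; the vertices
   of [R] were joined to their neighbours in [K] only when they were added,
   those of [X :\: K :\: R] to one further vertex. *)
Record partial G K X R H : Prop := Partial {
  partialKX : K \subset X;
  partialXV : X \subset vset G;
  partialR : R \subset X :\: K;
  partial_sub : subgraph H G;
  partial_chordal : chordal H;
  partial_adjX : forall x y, adj H x y -> x \in X;
  partial_adjK : forall x y, x \in X -> y \in K -> adj G x y -> adj H x y;
  partial_card : #|eset H| =
    'C(#|K|, 2) + \sum_(u in X :\: K) #|nbr G u :&: K| + #|X :\: K :\: R|;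
  partial_dom : \sum_(u in R) #|dominating G K u| <=
    #|X :\: K :\: R| + #|pending G K X| }.

(** A pending vertex is added if there is one, otherwise a vertex with [#|nbr G u :&: K|] maximum.
    In the first case [partial_dom] survives because [X :\: K :\: R] gains [u] and only [u] stops
    being pending; in the second, because nothing was pending and every vertex dominating [u]
    becomes so. *)
Lemma partial_step G K X R H : partial G K X R H -> X != vset G ->
  {in K &, forall x y, x != y -> adj G x y} ->
  exists u R' H', u \in vset G :\: X /\ partial G K (u |: X) R' H'.
Proof.
move=> [KX XV RX HG chH HX HK cH dH] neX Kcl.
have subK u : u \notin X -> (u |: X) :\: K = u |: (X :\: K).
  move=> uX; apply/setP=> w; rewrite !inE; case: eqP => //= ->.
  by rewrite (contra (subsetP KX u) uX).
have KclH : {in K &, forall x y, x != y -> adj H x y}.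
  by move=> x y xK yK xy; apply: HK => //; [apply: (subsetP KX)|apply: Kcl].
have H0 u : u \notin X -> forall x, ~~ adj H u x.
  by move=> uX x; apply: contra uX; apply: HX.
have [p0|[u]] := set_0Vmem (pending G K X).
  have [u0 u0P] : exists u, u \in vset G :\: X.
    by apply/set0Pn; rewrite setD_eq0; apply: contraNN neX => VX; rewrite eqEsubset XV.
  case: (arg_maxnP (fun u => #|nbr G u :&: K|) u0P) => u uP umax.
  have /setDP[uV uX] := uP; have uXK : u \notin X :\: K by rewrite inE (negPf uX) andbF.
  have [|H' [H'G chH' cH' adjH']] :=
      add_simplicial G H u (nbr G u :&: K) HG chH (subsetIl _ _) (H0 u uX).
    by move=> x y /setIP[_ xK] /setIP[_ yK]; apply: KclH.
  have uR : u \notin R by apply: contra uXK; apply: (subsetP RX).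
  have DE : (u |: X) :\: K :\: (u |: R) = X :\: K :\: R.
    rewrite subK //; apply/setP=> w; rewrite !inE; case: eqP => //= ->.
    by rewrite (negPf uX) !andbF.
  exists u, (u |: R), H'; split=> //; split=> //.
  - exact: subset_trans KX (subsetUr _ _).
  - by rewrite subUset sub1set uV.
  - by rewrite subK // setUS.
  - move=> x y; rewrite adjH' in_setU1 => /or3P[/HX->|/andP[->]|/andP[_ /setIP[_]]] //.
      by rewrite orbT.
    by move/(subsetP KX)->; rewrite orbT.
  - move=> x y /setU1P[->|xX] yK xy; rewrite adjH'.
      by rewrite eqxx inE yK inE xy /= orbT.
    by rewrite HK.
  - by rewrite DE cH' cH subK // big_setU1 //=; ring.
  - rewrite DE big_setU1 //= addnC leq_add //.
      by apply: leq_trans dH _; rewrite p0 cards0 addn0.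
    apply/subset_leq_card/subsetP=> w; rewrite inE => /andP[wu].
    rewrite inE in wu => uw.
    have wV : w \in vset G by apply: (adj_vset G w u); rewrite adjC.
    have wX : w \notin X.
      apply/negP=> wX; have [wK|wK] := boolP (w \in K).
        have := subsetP uw w; rewrite !inE wu wK => /(_ isT).
        by rewrite adjxx.
      have : u \in pending G K X; last by rewrite p0 inE.
      by rewrite !inE uX uV; apply/existsP; exists w; rewrite !inE wK wX wu.
    (* Maximality turns the inclusion into an equality, which gives the reverse inclusion that
       [pending] asks for. *)
    have uw' : nbr G u :&: K = nbr G w :&: K.
      apply/eqP; rewrite eqEcard; apply/andP; split; last by apply: umax; apply/setDP.
      by apply/subsetP=> x xuK; rewrite inE (subsetP uw) //; case/setIP: xuK.
    rewrite !inE wV negb_or wX eq_sym (adj_neq G u w wu) /=; apply/existsP; exists u.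
    by rewrite !inE eqxx adjC wu (contra (subsetP KX u)) //= -uw' subsetIl.
rewrite inE => /andP[uP /existsP[w /and3P[/setDP[wX wK] uw suw]]].
have /setDP[uV uX] := uP; have uXK : u \notin X :\: K by rewrite inE (negPf uX) andbF.
have [||H' [H'G chH' cH' adjH']] :=
    add_simplicial G H u (w |: nbr G u :&: K) HG chH _ (H0 u uX).
- by rewrite subUset sub1set subsetIl inE uw.
- have wuK x : x \in nbr G u :&: K -> adj H w x.
    by move=> xuK; apply: HK => //; [case/setIP: xuK|move/(subsetP suw): xuK; rewrite inE].
  move=> x y /setU1P[->|xuK] /setU1P[->|yuK].
  + by rewrite eqxx.
  + by move=> _; apply: wuK.
  + by move=> _; rewrite adjC; apply: wuK.
  by case/setIP: xuK yuK => _ xK /setIP[_ yK]; apply: KclH.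
have uR : u \notin R by apply: contra uXK; apply: (subsetP RX).
have DE : (u |: X) :\: K :\: R = u |: (X :\: K :\: R).
  by rewrite subK //; apply/setP=> x; rewrite !inE; case: eqP => //= ->; rewrite uR.
have cDE : #|(u |: X) :\: K :\: R| = #|X :\: K :\: R|.+1.
  by rewrite DE cardsU1 !inE (negPf uX) !andbF.
exists u, R, H'; split=> //; split=> //.
- exact: subset_trans KX (subsetUr _ _).
- by rewrite subUset sub1set uV.
- by rewrite subK //; apply: subset_trans RX (subsetUr _ _).
- move=> x y; rewrite adjH' => /or3P[/HX xX|/andP[xu _]|/andP[_]].
  + by rewrite in_setU1 xX orbT.
  + by rewrite in_setU1 xu.
  by case/setU1P=> [->|/setIP[_ /(subsetP KX) xX]]; rewrite in_setU1 ?wX ?xX orbT.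
- move=> x y /setU1P[->|xX] yK xy; rewrite adjH'.
    by rewrite eqxx !inE yK xy /= !orbT.
  by rewrite HK.
- rewrite cH' cH cDE subK // big_setU1 //= cardsU1 inE (negPf wK) andbF /=; ring.
- rewrite cDE; apply: leq_trans dH _; rewrite addSnnS leq_add2l.
  rewrite (cardsD1 u) -[X in _ <= X]add1n leq_add ?leq_b1 //.
  apply/subset_leq_card/subsetP=> x; rewrite !inE => /andP[xu].
  case/andP=> /andP[xX xV] /existsP[y /andP[/setDP[yX yK] xy]].
  by rewrite negb_or xu xX xV; apply/existsP; exists y; rewrite !inE yX yK xy orbT.
Qed.

Lemma partial_full G K : K \subset vset G ->
    {in K &, forall x y, x != y -> adj G x y} ->
  exists R H, partial G K (vset G) R H.
Proof.
move=> KV Kcl.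
suff ind k X R H : #|vset G :\: X| = k -> partial G K X R H ->
    exists R H, partial G K (vset G) R H.
  have [H [HG chH cH adjH]] := clique_chordal G K KV Kcl.
  apply: (ind _ K set0 H erefl); split=> //.
  - by rewrite sub0set.
  - by move=> x y; rewrite adjH => /andP[].
  - by move=> x y xK yK /adj_neq xy; rewrite adjH xK yK.
  - by rewrite cH setDv set0D cards0 big_set0 !addn0.
  - by rewrite big_set0.
elim: k X R H => [|k IHk] X R H cX pX; have [/eqP eX|neX] := boolP (X == vset G).
- by exists R, H; rewrite -eX.
- have XV := partialXV _ _ _ _ _ pX.
  by move/eqP: cX; rewrite cards_eq0 setD_eq0 => VX; rewrite eqEsubset XV VX in neX.
- by rewrite eX setDv cards0 in cX.
have [u [R' [H' [uP pX']]]] := partial_step G K X R H pX neX Kcl.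
apply: IHk pX'; apply: succn_inj; rewrite -cX [RHS](cardsD1 u) uP add1n; congr _.+1.
by apply: eq_card => x; rewrite !inE negb_or -andbA.
Qed.

End Grow.

(** * The lower bound *)

Section Arithmetic.
Local Open Scope ring_scope.

(** If [a1 + a2 >= n], the left-hand side is at least [a1 ^+ 2 + (n - a1) ^+ 2], hence at least half
    of [n ^+ 2], while [n ^+ 2 - 2 * m] is below a third of it. *)
Lemma arith_pair (n m a1 a2 : int) : n ^+ 2 < 3 * m ->
  a1 * a1 + (n - a1) * a2 <= n ^+ 2 - 2 * m -> a1 <= n -> a1 + a2 < n.
Proof.
move=> nm le an; rewrite ltNge; apply/negP=> na.
have h1 : 0 <= (n - a1) * (a1 + a2 - n) by rewrite mulr_ge0 ?subr_ge0.
have h2 : 0 <= (n - 2 * a1) ^+ 2 by rewrite sqr_ge0.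
have h3 : 0 <= n ^+ 2 by rewrite sqr_ge0.
lra.
Qed.

(** Put t = a1 + a2 + a3 - n and b = a3 - t/2. The left-hand side is a1^2 + a2^2 + b^2 - t^2/4,
    where a1 + a2 + b = n + t/2, so it is at least n^2/3 + t(2n - t)/6; [h1] makes the last term
    nonnegative. *)
Lemma arith_triple (n m a1 a2 a3 : int) : n ^+ 2 < 3 * m ->
  a1 ^+ 2 + a2 ^+ 2 + a3 ^+ 2 - (a1 + a2 + a3 - n) * a3 <= n ^+ 2 - 2 * m ->
  a1 <= n -> a2 <= n -> a3 <= n -> a1 + a2 + a3 < n.
Proof.
move=> nm le a1n a2n a3n; rewrite ltNge; apply/negP=> na.
pose t := a1 + a2 + a3 - n.
have h0 : 0 <= t by rewrite /t; lia.
have h1 : 0 <= t * (n - a1 + n - a2 + n - a3) by rewrite mulr_ge0 //; lra.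
have h2 : 0 <= (2 * a1 - (2 * a3 - t)) ^+ 2 by rewrite sqr_ge0.
have h3 : 0 <= (2 * a2 - (2 * a3 - t)) ^+ 2 by rewrite sqr_ge0.
have h4 : 0 <= (a1 - a2) ^+ 2 by rewrite sqr_ge0.
rewrite /t in h0 h1 h2 h3 h4; lra.
Qed.

(* The slack below comes from writing [a_i = n / 3 - e_i]: the cross term
   [2 * g * Y] is absorbed by [e_3 ^+ 2] because [g + Y] is at most about [- e_3]. *)
Lemma arith_main (n k r c m a1 a2 a3 s q g Y : int) :
  n = 3 * k + r -> (r = 0 /\ c = k) \/ ((r = 1 \/ r = 2) /\ c = k + 1) ->
  n ^+ 2 < 3 * m -> a1 + a2 + a3 = n - s -> 0 < s -> 0 <= g -> g <= q + 1 - c ->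
  0 <= Y -> Y = 0 \/ Y = a3 - q ->
  a1 ^+ 2 + a2 ^+ 2 + a3 ^+ 2 + (q + s) ^+ 2 - q ^+ 2 - g * (1 + s + 2 * Y)
    <= n ^+ 2 - 2 * m -> False.
Proof.
move=> nE rc nm sa s0 g0 gq Y0 Yc le.
have [h qE] : exists h, q = c - 1 + g + h by exists (q - (c - 1 + g)); ring.
have h0 : 0 <= h by clear -qE gq; lia.
have {gq} sh : 0 <= s * h by rewrite mulr_ge0 // ltW.
have s1 : 0 <= s - 1 by clear -s0; lia.
have gs : 0 <= g * (s - 1) by rewrite mulr_ge0.
pose e1 := k - a1; pose e2 := k - a2; pose e3 := k - a3.
have [a1E [a2E a3E]] : a1 = k - e1 /\ a2 = k - e2 /\ a3 = k - e3.
  by rewrite /e1 /e2 /e3; split; [|split]; ring.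
have sq1 : 0 <= e1 ^+ 2 by rewrite sqr_ge0.
have sq2 : 0 <= e2 ^+ 2 by rewrite sqr_ge0.
have sq3 : 0 <= e3 ^+ 2 by rewrite sqr_ge0.
have sq12 : 0 <= (e1 - e2) ^+ 2 by rewrite sqr_ge0.
have s2 : 1 <= s ^+ 2 by rewrite -[1]/(1 ^+ 2 : int) lerXn2r ?nnegrE //; lra.
have eE : e1 + e2 + e3 = s - r.
  have -> : e1 + e2 + e3 = 3 * k - (a1 + a2 + a3) by rewrite /e1 /e2 /e3; ring.
  by rewrite sa nE; ring.
clearbody e1 e2 e3; subst n a1 a2 a3 q.
have keE : k * (e1 + e2 + e3) = k * (s - r) by rewrite eE.
have zz : 0 <= (g - Y) ^+ 2 by rewrite sqr_ge0.
have zh : 0 <= h * (h + 2 * (g + Y)) by rewrite mulr_ge0 //; lra.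
have zs : 0 <= (s - 1) * (g + Y + h) by rewrite mulr_ge0 //; lra.
have ss : 0 <= (s - 1) ^+ 2 by rewrite sqr_ge0.
have e12 : (e1 + e2) ^+ 2 = (s - r - e3) ^+ 2.
  by congr (_ ^+ 2); rewrite -eE; ring.
have e3E : Y = 0 \/ e3 = k - c + 1 - (g + Y + h) by case: Yc => ->; [left|right; ring].
have {rc} [[r0 cE]|[[r1 cE]|[r2 cE]]] :
    (r = 0 /\ c = k) \/ (r = 1 /\ c = k + 1) \/ (r = 2 /\ c = k + 1).
  by clear -rc; lia.
(* In each case [m1] is [n ^+ 2 < 3 * m] rounded up to an integer bound on [m]. *)
- subst r c; have m1 : 3 * k ^+ 2 + 1 <= m by clear -nm; lia.
  by case: e3E => e3E; subst; lra.
- subst r c; have m1 : 3 * k ^+ 2 + 2 * k + 1 <= m by clear -nm; lia.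
  by case: e3E => e3E; subst; lra.
- subst r c; have m1 : 3 * k ^+ 2 + 4 * k + 2 <= m by clear -nm; lia.
  by case: e3E => e3E; subst; lra.
Qed.

End Arithmetic.

Lemma exists_max {T : finType} (A : {set T}) (h : T -> nat) : A != set0 ->
  exists2 x, x \in A & {in A, forall y, h y <= h x}.
Proof.
move=> /set0Pn[x0 x0A]; case: (arg_maxnP h x0A) => x xA hx.
by exists x => // y; apply: hx.
Qed.

(** * Case analysis on the adjacencies of one vertex to the clique *)

Section Pointwise.
Local Open Scope ring_scope.
Context (x1 x2 x3 x4 : bool) (a1 a2 a3 a4 q co : int).
Let N (x : bool) : int := (~~ x)%:R.
Hypotheses (q0 : 0 <= q) (qa : q < a4) (l1 : a1 <= co) (l2 : x1 ==> (a2 <= co))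
  (l3 : x1 && x2 ==> (a3 <= co)) (l4 : [&& x1, x2 & x3] ==> (a4 <= co)).

(** If at least two of the [x]s are false, the hypothesis suffices, since then at least one [q] is
    subtracted. If exactly one is false, the greedy bound for it applies; if none is,
    [q < a4 <= co]. *)
Lemma rep_bound (d : int) : 0 <= d ->
  N x1 * a1 + N x2 * a2 + N x3 * a3 + N x4 * a4 - q <= co + d ->
  N x1 * a1 + N x2 * a2 + N x3 * a3 + N x4 * a4
    - (N x1 + N x2 + N x3 + N x4 - 1) * q <= co + d.
Proof.
move: q0 qa l1 l2 l3 l4; rewrite /N.
by case: x1; case: x2; case: x3; case: x4 => /= p0 pa m1 m2 m3 m4 d0 l; lra.
Qed.

(** The first false [x] contributes at most [co] by the greedy bound. Each later one adds its
    [a - q]: at most [Y] for the second and third, [a4 - q] for the fourth. *)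
Lemma gain_bound (Y : int) : a1 <= a2 -> a2 <= a3 -> 0 <= Y -> a3 - q <= Y ->
  N x1 * a1 + N x2 * a2 + N x3 * a3 + N x4 * a4
    - (N x1 + N x2 + N x3 + N x4 - 1) * q <= co + (a4 - q + 2 * Y).
Proof.
move: q0 qa l1 l2 l3 l4; rewrite /N.
by case: x1; case: x2; case: x3; case: x4 => /= p0 pa m1 m2 m3 m4 *; lra.
Qed.

(** As in [gain_bound], with [a3] in place of [q], so that the later terms are not positive. *)
Lemma triple_bound : a1 <= a2 -> a2 <= a3 ->
  N x1 * a1 + N x2 * a2 + N x3 * a3 - (N x1 + N x2 + N x3 - 1) * a3 <= co.
Proof.
move: l1 l2 l3; rewrite /N.
by case: x1; case: x2; case: x3 => /= *; lra.
Qed.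

End Pointwise.

Lemma sumz {I : finType} (A : {set I}) (h : I -> nat) :
  Posz (\sum_(x in A) h x)%N = (\sum_(x in A) (h x)%:Z)%R.
Proof. exact: (big_morph Posz PoszD erefl). Qed.

(** * The greedy clique and the degree count *)

Section Lower.
Context {T : finType} (G : graph T).
Local Open Scope ring_scope.
Local Notation V := (vset G).
Local Notation n := (#|vset G|%:Z).
Local Notation m := (#|eset G|%:Z).

Definition codeg (x : T) : int := n - #|nbr G x|%:Z.
Definition nonadj (x y : T) : int := (~~ adj G x y)%:R.

Lemma sum_nonadj x : \sum_(y in V) nonadj x y = codeg x.
Proof.
rewrite /codeg -(cardsID (nbr G x) V) PoszD (setIidPr (nbr_sub G x)).
rewrite addrC addKr /nonadj; under eq_bigr do rewrite natz.
rewrite -sumz sum_mem.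
by congr Posz; apply: eq_card => y; rewrite !inE andbC.
Qed.

Lemma sum_cst (A : {set T}) (c : int) : \sum_(x in A) c = #|A|%:Z * c.
Proof. by rewrite sumr_const -mulr_natl natz. Qed.

Lemma sum_codeg : \sum_(x in V) codeg x = n ^+ 2 - 2 * m.
Proof.
rewrite /codeg sumrB sum_cst expr2 -sumz handshake.
by rewrite PoszM.
Qed.

Lemma codeg_le x : codeg x <= n. Proof. by rewrite /codeg; lia. Qed.

(** If the vertices chosen so far had no common neighbour, every vertex would miss one of them and
    their codegrees would sum to at least [n]. The greedy choice bounds the total codegree from
    below ([I1], [I2], [I3]), which rules this out. *)
Lemma greedy_K4 : n ^+ 2 < 3 * m -> exists v1 v2 v3 v4 : T,
  [/\ [/\ v1 \in V, adj G v1 v2, adj G v1 v3 & adj G v1 v4],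
      [/\ adj G v2 v3, adj G v2 v4 & adj G v3 v4],
      codeg v1 + codeg v2 + codeg v3 < n
    & [/\ {in V, forall u, codeg v1 <= codeg u},
      forall u, adj G v1 u -> codeg v2 <= codeg u,
      forall u, adj G v1 u -> adj G v2 u -> codeg v3 <= codeg u
    & forall u, adj G v1 u -> adj G v2 u -> adj G v3 u -> codeg v4 <= codeg u]].
Proof.
move=> nm.
have maxE (A : {set T}) : A != set0 ->
    exists2 x, x \in A & {in A, forall y, codeg x <= codeg y}.
  move=> /(exists_max A (fun x => #|nbr G x|))[x xA hx]; exists x => // y /hx.
  by rewrite /codeg; lia.
have n0 : 0 <= n ^+ 2 by rewrite sqr_ge0.
have [|v1 v1V h1] := maxE V.
  apply: contraTneq nm => V0; rewrite -leNgt.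
  have : \sum_(x in V) codeg x = 0 by rewrite V0 big_set0.
  by rewrite sum_codeg V0 cards0; lia.
have I1 : n * codeg v1 <= n ^+ 2 - 2 * m.
  by rewrite -sum_codeg -sum_cst; apply: ler_sum.
have [|v2 v2N h2'] := maxE (nbr G v1).
  apply/negP=> /eqP N0; move: I1; rewrite /codeg N0 cards0 subr0 -expr2; lia.
have h2 u : adj G v1 u -> codeg v2 <= codeg u by move=> uv; apply: h2'; rewrite inE.
rewrite inE in v2N; have v2V : v2 \in V by apply: (adj_vset G v2 v1); rewrite adjC.
(* Non-neighbours of [v1] have codegree at least that of [v1], its neighbours at least that of
   [v2]. *)
have I2 : codeg v1 * codeg v1 + (n - codeg v1) * codeg v2 <= n ^+ 2 - 2 * m.
  apply: (@le_trans _ _ (\sum_(u in V) (nonadj v1 u * codeg v1 + (1 - nonadj v1 u) * codeg v2))).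
    by rewrite big_split /= -!mulr_suml sumrB sum_nonadj sum_cst mulr1.
  rewrite -sum_codeg; apply: ler_sum => u uV; rewrite /nonadj.
  by case: (boolP (adj G v1 u)) => [/h2|_] /=; have := h1 u uV; lia.
have S2 := arith_pair _ _ _ _ nm I2 (codeg_le v1).
have [|v3 v3N h3'] := maxE (nbr G v1 :&: nbr G v2).
  apply/negP=> /eqP N0; move: S2; rewrite ltNge => /negP[].
  rewrite -!sum_nonadj -big_split /= -[X in X <= _]mulr1 -sum_cst; apply: ler_sum => u uV.
  have : u \notin nbr G v1 :&: nbr G v2 by rewrite N0 inE.
  by rewrite !inE /nonadj; case: (adj G v1 u); case: (adj G v2 u).
have h3 u : adj G v1 u -> adj G v2 u -> codeg v3 <= codeg u.
  by move=> uv1 uv2; apply: h3'; rewrite !inE uv1.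
have /andP[v13 v23] : adj G v1 v3 && adj G v2 v3 by rewrite !inE in v3N.
have v3V : v3 \in V by apply: (adj_vset G v3 v1); rewrite adjC.
have I3 : codeg v1 ^+ 2 + codeg v2 ^+ 2 + codeg v3 ^+ 2
    - (codeg v1 + codeg v2 + codeg v3 - n) * codeg v3 <= n ^+ 2 - 2 * m.
  apply: (@le_trans _ _ (\sum_(u in V) (nonadj v1 u * codeg v1 + nonadj v2 u * codeg v2
     + nonadj v3 u * codeg v3 - (nonadj v1 u + nonadj v2 u + nonadj v3 u - 1) * codeg v3))).
    rewrite sumrB !big_split /= -!mulr_suml sumrB !big_split /= !sum_nonadj sum_cst mulr1.
    by rewrite !expr2.
  rewrite -sum_codeg; apply: ler_sum => u uV.
  have k3 : adj G v1 u && adj G v2 u ==> (codeg v3 <= codeg u).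
    by apply/implyP=> /andP[]; apply: h3.
  apply: triple_bound => //; [exact: h1|exact/implyP/h2|exact: h1|exact: h2].
have S3 := arith_triple _ _ _ _ _ nm I3 (codeg_le v1) (codeg_le v2) (codeg_le v3).
have [|v4 v4N h4'] := maxE (nbr G v1 :&: nbr G v2 :&: nbr G v3).
  apply/negP=> /eqP N0; move: S3; rewrite ltNge => /negP[].
  rewrite -!sum_nonadj -!big_split /= -[X in X <= _]mulr1 -sum_cst; apply: ler_sum => u uV.
  have : u \notin nbr G v1 :&: nbr G v2 :&: nbr G v3 by rewrite N0 inE.
  by rewrite !inE /nonadj; case: (adj G v1 u); case: (adj G v2 u); case: (adj G v3 u).
exists v1, v2, v3, v4; move: v4N; rewrite !inE => /andP[/andP[v14 v24] v34].
by split=> //; split=> // u uv1 uv2 uv3; apply: h4'; rewrite !inE uv1 uv2.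
Qed.

Section Clique.
Context (v1 v2 v3 v4 : T).
Hypotheses (v1V : v1 \in V)
  (v12 : adj G v1 v2) (v13 : adj G v1 v3) (v14 : adj G v1 v4)
  (v23 : adj G v2 v3) (v24 : adj G v2 v4) (v34 : adj G v3 v4).
Let K := [set v1; v2; v3; v4].
Let a1 := codeg v1. Let a2 := codeg v2. Let a3 := codeg v3. Let a4 := codeg v4.
Let b1 u := nonadj v1 u. Let b2 u := nonadj v2 u.
Let b3 u := nonadj v3 u. Let b4 u := nonadj v4 u.
Let q := a1 + a2 + a3 + a4 - n.

Lemma K4_subset : K \subset V.
Proof.
have inV x y : adj G x y -> y \in V by rewrite adjC; apply: adj_vset.
by rewrite !subUset !sub1set v1V (inV _ _ v12) (inV _ _ v13) (inV _ _ v14).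
Qed.

Lemma K4_clique : {in K &, forall x y, x != y -> adj G x y}.
Proof.
move=> x y; rewrite !inE -!orbA => /or4P[]/eqP-> /or4P[]/eqP->; rewrite ?eqxx // => _;
by [|rewrite adjC].
Qed.

Lemma big_K4 (R : Type) (idx : R) (op : Monoid.com_law idx) (F : T -> R) :
  \big[op/idx]_(u in K) F u = op (op (op (F v1) (F v2)) (F v3)) (F v4).
Proof.
have [n12 n13 n14] := And3 (adj_neq _ _ _ v12) (adj_neq _ _ _ v13) (adj_neq _ _ _ v14).
have [n23 n24 n34] := And3 (adj_neq _ _ _ v23) (adj_neq _ _ _ v24) (adj_neq _ _ _ v34).
rewrite /K setUC big_setU1 ?inE ?negb_or ?[v4 == _]eq_sym ?n14 ?n24 ?n34 //=.
rewrite setUC big_setU1 ?inE ?negb_or ?[v3 == _]eq_sym ?n13 ?n23 //=.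
rewrite setUC big_setU1 ?inE ?[v2 == _]eq_sym ?n12 //= big_set1.
by rewrite Monoid.mulmC [op (F v3) _]Monoid.mulmC [op (F v2) _]Monoid.mulmC.
Qed.

Lemma card_K4 : #|K| = 4%N.
Proof. by rewrite -sum1_card big_K4. Qed.

Lemma card_nbrK4 u : #|nbr G u :&: K|%:Z = 4 - (b1 u + b2 u + b3 u + b4 u).
Proof.
have -> : #|nbr G u :&: K| = (\sum_(x in K) adj G x u)%N.
  by rewrite sum_mem; apply: eq_card => x; rewrite !inE adjC andbC.
rewrite big_K4 /b1 /b2 /b3 /b4 /nonadj.
by do 4![case: (adj G _ u)].
Qed.

Lemma sum_card_nbrK4 :
  (\sum_(u in V :\: K) #|nbr G u :&: K|)%N%:Z = 3 * n - q - 12.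
Proof.
have : (\sum_(u in V) #|nbr G u :&: K|)%N%:Z = 3 * n - q.
  rewrite sumz; under eq_bigr do rewrite card_nbrK4.
  rewrite sumrB sum_cst !big_split /= !sum_nonadj.
  rewrite /q /a1 /a2 /a3 /a4; ring.
rewrite (big_setID K) /= (setIidPr K4_subset) PoszD => <-.
have -> : (\sum_(u in K) #|nbr G u :&: K|)%N%:Z = 12.
  rewrite sumz; under eq_bigr do rewrite card_nbrK4.
  rewrite big_K4 /= /b1 /b2 /b3 /b4 /nonadj !adjxx !v12 !v13 !v14 !v23 !v24 !v34.
  by rewrite ![adj G v2 v1]adjC ![adj G v3 _]adjC ![adj G v4 _]adjC v12 v13 v14 v23 v24 v34.
ring.
Qed.

(* The left-hand side is the sum over [w] of [1 - #|K :&: nbr G u :\: nbr G w|],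
   whose only positive terms come from [w] with [nbr G u :&: K \subset nbr G w]. *)
Lemma codeg_dominating u : u \in V ->
  b1 u * a1 + b2 u * a2 + b3 u * a3 + b4 u * a4 - q <=
  codeg u + #|dominating G K u|%:Z.
Proof.
move=> uV; pose U := [set w in V | nbr G u :&: K \subset nbr G w].
(* Members of [U] adjacent to [u] dominate it; the others are counted by [codeg u]. *)
apply: (@le_trans _ _ #|U|%:Z); last first.
  apply: (@le_trans _ _ #|V :\: nbr G u :|: dominating G K u|%:Z).
    rewrite lez_nat subset_leq_card //; apply/subsetP=> w; rewrite !inE.
    by case/andP=> -> ->; rewrite !andbT orNb.
  apply: (@le_trans _ _ (#|V :\: nbr G u| + #|dominating G K u|)%N%:Z).
    by rewrite lez_nat cardsU leq_subr.
  rewrite PoszD lerD2r /codeg -(cardsID (nbr G u) V) (setIidPr (nbr_sub G u)).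
  by rewrite PoszD addrAC subrr add0r.
have UE w : (nbr G u :&: K \subset nbr G w) =
    [&& adj G v1 u ==> adj G v1 w, adj G v2 u ==> adj G v2 w,
        adj G v3 u ==> adj G v3 w & adj G v4 u ==> adj G v4 w].
  apply/subsetP/and4P => [sub|[/implyP i1 /implyP i2 /implyP i3 /implyP i4] x].
    split; apply/implyP=> vu; rewrite adjC; [move: (sub v1)|move: (sub v2)|
      move: (sub v3)|move: (sub v4)]; rewrite !inE eqxx ?orbT andbT adjC; exact.
  rewrite !inE -!orbA adjC => /andP[xu /or4P[]/eqP xE]; rewrite adjC; subst x;
  by [apply: i1|apply: i2|apply: i3|apply: i4].
rewrite -sum_mem sumz.
apply: (@le_trans _ _ (\sum_(w in V) (1 - ((1 - b1 u) * b1 w + (1 - b2 u) * b2 w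
    + (1 - b3 u) * b3 w + (1 - b4 u) * b4 w)))).
  rewrite sumrB !big_split /= -!mulr_sumr !sum_nonadj sum_cst.
  by rewrite le_eqVlt; apply/orP; left; apply/eqP; rewrite /q /a1 /a2 /a3 /a4; ring.
apply: ler_sum => w _; rewrite UE.
have bE v : (1 - nonadj v u) * nonadj v w = (~~ (adj G v u ==> adj G v w))%:R.
  by rewrite /nonadj; case: (adj G v u); case: (adj G v w).
rewrite /b1 /b2 /b3 /b4 !bE.
by do 4![case: (_ ==> _)].
Qed.

Hypotheses (h1 : {in V, forall u, a1 <= codeg u})
  (h2 : forall u, adj G v1 u -> a2 <= codeg u)
  (h3 : forall u, adj G v1 u -> adj G v2 u -> a3 <= codeg u)
  (h4 : forall u, adj G v1 u -> adj G v2 u -> adj G v3 u -> a4 <= codeg u).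
Hypotheses (q0 : 0 <= q).
(** Unfolding [q] gives [n - (a1 + a2 + a3)], which is positive for the greedy clique. *)
Let s := a4 - q.
Hypothesis (s0 : 0 < s).
Let rhs u := b1 u * a1 + b2 u * a2 + b3 u * a3 + b4 u * a4
  - (b1 u + b2 u + b3 u + b4 u - 1) * q.

Lemma sum_rhs : \sum_(u in V) rhs u =
  a1 ^+ 2 + a2 ^+ 2 + a3 ^+ 2 + (q + s) ^+ 2 - q ^+ 2.
Proof.
rewrite sumrB !big_split /= -!mulr_suml sumrB !big_split /= !sum_nonadj.
rewrite sum_cst /s /q /a1 /a2 /a3 /a4; ring.
Qed.

(** A clique vertex misses only itself in [K], so both sides are equal. *)
Lemma codeg_K4 u : u \in K -> rhs u <= codeg u.
Proof.
rewrite !inE -!orbA /rhs /b1 /b2 /b3 /b4 /nonadj => /or4P[]/eqP->;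
rewrite ?adjxx ?[adj G v2 v1]adjC ?[adj G v3 v1]adjC ?[adj G v3 v2]adjC ?[adj G v4 _]adjC
  ?v12 ?v13 ?v14 ?v23 ?v24 ?v34 /= -/a1 -/a2 -/a3 -/a4; lia.
Qed.

Lemma greedy_bounds u : u \in V ->
  [/\ a1 <= codeg u, adj G v1 u ==> (a2 <= codeg u),
      adj G v1 u && adj G v2 u ==> (a3 <= codeg u)
    & [&& adj G v1 u, adj G v2 u & adj G v3 u] ==> (a4 <= codeg u)].
Proof.
move=> uV; split; first exact: h1; apply/implyP; first exact: h2.
  by case/andP; apply: h3.
by case/and3P; apply: h4.
Qed.

Lemma codeg_rep u : u \in V -> rhs u <= codeg u + #|dominating G K u|%:Z.
Proof.
move=> uV; have [l1 l2 l3 l4] := greedy_bounds u uV.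
apply: rep_bound (codeg_dominating u uV) => //.
by rewrite -subr_gt0.
Qed.

Lemma codeg_gain u (Y : int) : u \in V -> 0 <= Y -> a3 - q <= Y ->
  rhs u <= codeg u + (s + 2 * Y).
Proof.
move=> uV Y0 Yq; have [l1 l2 l3 l4] := greedy_bounds u uV.
apply: gain_bound => //; first by rewrite -subr_gt0.
  by apply/h1/(subsetP K4_subset); rewrite !inE eqxx ?orbT.
exact: h2.
Qed.

End Clique.

Lemma chordal_lower (k r c : int) : n = 3 * k + r ->
    (r = 0 /\ c = k) \/ ((r = 1 \/ r = 2) /\ c = k + 1) -> n ^+ 2 < 3 * m ->
  exists H, [/\ subgraph H G, chordal H & 3 * n - c - 4 <= #|eset H|%:Z].
Proof.
move=> nE rc nm.
have [v1 [v2 [v3 [v4 [[v1V v12 v13 v14] [v23 v24 v34] s3 [h1 h2 h3 h4]]]]]] := greedy_K4 nm.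
pose K := [set v1; v2; v3; v4].
have KV := K4_subset v1 v2 v3 v4 v1V v12 v13 v14.
have [R [H pH]] := partial_full G K KV (K4_clique v1 v2 v3 v4 v12 v13 v14 v23 v24 v34).
exists H; split; [exact: partial_sub pH|exact: partial_chordal pH|].
rewrite leNgt; apply/negP=> ltH.
pose g : int := #|V :\: K :\: R|%:Z.
pose q := codeg v1 + codeg v2 + codeg v3 + codeg v4 - n.
pose s := codeg v4 - q; pose Y := Num.max 0 (codeg v3 - q).
(* The grown graph has 6 + (3n - q - 12) + g edges, assumed to be at most 3n - c - 5. *)
have gq : g <= q + 1 - c.
  move: ltH; rewrite (partial_card _ _ _ _ _ pH) card_K4 //.
  have S := sum_card_nbrK4 v1 v2 v3 v4 v1V v12 v13 v14 v23 v24 v34.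
  rewrite (_ : 'C(4, 2)%N = 6%N) // !PoszD S -/g -/q; clear; lia.
have g0 : 0 <= g by [].
have q0 : 0 <= q.
  have : 1 <= c by case: rc; lia.
  lia.
have s0 : 0 < s by rewrite /s /q; lia.
have [Y0 Yq] : 0 <= Y /\ codeg v3 - q <= Y by rewrite /Y; lia.
have Ye : Y = 0 \/ Y = codeg v3 - q by rewrite /Y; lia.
apply: (arith_main n k r c m (codeg v1) (codeg v2) (codeg v3) s q g Y) => //.
  rewrite /s /q; ring.
rewrite -sum_rhs -sum_codeg lerBlDr.
(* The error allowed at [u] in the bound of [rhs u] by [codeg u]. *)
pose def u : int := if u \in K then 0 else if u \in R then #|dominating G K u|%:Z else s + 2 * Y.
apply: (@le_trans _ _ (\sum_(u in V) (codeg u + def u))).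
  apply: ler_sum => u uV; rewrite /def.
  case: ifP => uK; first by rewrite addr0 codeg_K4.
  by case: ifP => uR; [apply: codeg_rep|apply: codeg_gain].
rewrite big_split lerD2l /= (big_setID K) /= (setIidPr KV) big1 => [|u uK]; last by rewrite /def uK.
rewrite add0r (big_setID R) /= (setIidPr (partialR _ _ _ _ _ pH)).
have -> : \sum_(u in R) def u = (\sum_(u in R) #|dominating G K u|)%N%:Z.
  rewrite sumz; apply: eq_bigr => u uR; rewrite /def uR ifN //.
  by have := subsetP (partialR _ _ _ _ _ pH) u uR; rewrite inE => /andP[].
have -> : \sum_(u in V :\: K :\: R) def u = g * (s + 2 * Y).
  rewrite -sum_cst; apply: eq_bigr => u.
  by case/setDP=> /setDP[_ /negPf uK] /negPf uR; rewrite /def uK uR.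
(* All vertices have been added, so nothing is pending and the errors over [R] sum to at most
   [g]. *)
have := partial_dom _ _ _ _ _ pH; rewrite (_ : pending _ _ _ = set0) ?cards0 ?addn0.
  rewrite -lez_nat -/g (_ : g * (1 + s + 2 * Y) = g + g * (s + 2 * Y)); last by ring.
  by rewrite lerD2r.
by apply/setP=> w; rewrite !inE; case: (w \in V).
Qed.
End Lower.

(** * The upper bound *)

Section Forest.
Context {T : finType} (H : graph T) (Z : {set T}) (col : T -> bool).
Hypotheses (chH : chordal H)
  (colP : {in Z &, forall x y, adj H x y -> col x != col y}).

(** Two colours exclude triangles; a longer cycle has a chord, which closes a shorter cycle. *)
Lemma no_cycle c : 2 < size c -> uniq c -> {subset c <= Z} -> ~ cycle (adj H) c.
Proof.
have [k] := ubnP (size c); elim: k c => // k IHk c ck c3 uc cZ cc.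
have [c4|] := ltnP 3 (size c); last first.
  case: c c3 uc cZ cc {ck} => [|x [|y [|z [|]]]] //= _ _ cZ.
  have [xZ yZ zZ] : [/\ x \in Z, y \in Z & z \in Z].
    by split; apply: cZ; rewrite !inE eqxx ?orbT.
  case/and4P=> /(colP _ _ xZ yZ) + /(colP _ _ yZ zZ) + /(colP _ _ zZ xZ).
  by case: (col x); case: (col y); case: (col z).
apply: (chH _ c4); split=> // x y xc yc xy.
have [->|yx] := eqVneq y (next c x); first by left.
have [->|xny] := eqVneq x (next c y); first by right.
exfalso.
have [i d cE] := rot_to xc.
have yd : y \in d.
  have : y \in x :: d by rewrite -cE mem_rot.
  by rewrite inE eq_sym (negPf (adj_neq _ _ _ xy)).
rewrite -(next_rot i uc) cE in yx; rewrite -(next_rot i uc) cE in xny.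
have ud : uniq (x :: d) by rewrite -cE rot_uniq.
have cd : cycle (adj H) (x :: d) by rewrite -cE rot_cycle.
have sd : size c = (size d).+1 by rewrite -(size_rot i) cE.
case/splitPr: yd yx xny ud cd sd cE => p1 p2 yx xny ud cd sd cE.
(* The chord is not an edge of the cycle, so both arcs [p1] and [p2] between its ends are nonempty;
   it closes up [p1]. *)
case: p2 => [|z p2] in yx xny ud cd sd cE.
  move: xny; rewrite -cat_cons cats1 -(next_rotr 1) ?rotr1_rcons /= ?eqxx //.
  by rewrite -cats1.
case: p1 => [|w p1] in yx xny ud cd sd cE.
  by move: yx; rewrite /= !eqxx.
apply: (IHk (x :: rcons (w :: p1) y)).
- by rewrite /= size_rcons; rewrite sd size_cat /= in ck; lia.
- by rewrite /= size_rcons.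
- by move: ud; rewrite -cat_rcons -cat_cons cat_uniq => /andP[].
- move=> v vc; apply: cZ; rewrite -(mem_rot i) cE -cat_rcons -cat_cons mem_cat.
  by rewrite vc.
- move: cd; rewrite /= -cat_rcons rcons_path cat_path => /and3P[xw /andP[py _] _].
  by rewrite rcons_path xw py last_rcons adjC xy.
Qed.

(** Otherwise a path in [Z] could be prolonged forever: its end has a neighbour in [Z] besides its
    predecessor, and by [no_cycle] that neighbour is off the path. *)
Lemma exists_leaf : Z != set0 -> exists2 v, v \in Z & #|nbr H v :&: Z| <= 1.
Proof.
case/set0Pn=> z0 z0Z; apply/exists_inP; apply: contraT => /exists_inPn deg.
suff long k : exists x p, [/\ size p = k, uniq (x :: p), {subset x :: p <= Z}
    & path (adj H) x p].
  have [x [p [sp up _ _]]] := long #|T|.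
  by have := max_card (mem (x :: p)); rewrite (card_uniqP up) /= sp ltnn.
elim: k => [|k [x [p [sp up pZ pp]]]].
  by exists z0, [::]; split=> // x; rewrite inE => /eqP->.
have xZ : x \in Z by apply: pZ; rewrite mem_head.
have [/subsetP sub|/subsetPn[y]] := boolP (nbr H x :&: Z \subset x :: p); last first.
  rewrite !inE => /andP[xy yZ] yp; exists y, (x :: p).
  rewrite /= sp yp [adj H y x]adjC xy; split=> // v.
  by rewrite inE => /orP[/eqP->|/pZ].
have /card_gt1P[a [b [aN bN ab]]] : 1 < #|nbr H x :&: Z| by rewrite ltnNge deg.
(* [head x p] is the predecessor of [x]; for empty [p] it defaults to [x], which is not its own
   neighbour. *)
have [y yN yp] : exists2 y, y \in nbr H x :&: Z & y != head x p.
  by have [ah|] := eqVneq a (head x p); [exists b; rewrite -?ah 1?eq_sym|exists a].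
have := sub y yN; move: yN; rewrite !inE => /andP[xy yZ].
rewrite eq_sym (negPf (adj_neq _ _ _ xy)) /= => yinp.
case/splitPr: yinp sp up pZ pp yp => p1 p2 _ up pZ pp yp.
case: p1 => [|w p1] in up pZ pp yp; first by rewrite /= eqxx in yp.
case: (@no_cycle (x :: rcons (w :: p1) y)).
- by rewrite /= size_rcons.
- by move: up; rewrite -cat_rcons -cat_cons cat_uniq => /andP[].
- by move=> v vc; apply: pZ; rewrite -cat_rcons -cat_cons mem_cat vc.
- move: pp; rewrite -cat_rcons cat_path => /andP[pp _].
  rewrite (_ : cycle _ _ = path (adj H) x (rcons (rcons (w :: p1) y) x)) //.
  by rewrite rcons_path pp last_rcons adjC xy.
Qed.

End Forest.

(** Deleting a leaf removes at most one edge. *)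
Lemma chordal_bipartite_card {T : finType} (H : graph T) (col : T -> bool) (Z : {set T}) :
  chordal H -> {in Z &, forall x y, adj H x y -> col x != col y} ->
  Z != set0 -> #|[set e in eset H | e \subset Z]| < #|Z|.
Proof.
move=> chH; have [k] := ubnP #|Z|; elim: k Z => // k IHk Z Zk colP Z0.
have [v vZ degv] := exists_leaf H Z col chH colP Z0.
have cZ := cardsD1 v Z; rewrite vZ add1n in cZ.
have sub : [set e in eset H | e \subset Z] \subset
    [set e in eset H | e \subset Z :\ v] :|: [set [set v; y] | y in nbr H v :&: Z].
  apply/subsetP=> e; rewrite !inE => /andP[eH eZ]; rewrite eH /=.
  have [ve|ve] := boolP (v \in e); last by rewrite subsetD1 eZ ve.
  apply/orP; right; have [y vy eE] := edge_adj _ _ _ eH ve.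
  apply/imsetP; exists y => //; rewrite !inE vy (subsetP eZ) // eE set22 //.
apply: leq_ltn_trans (subset_leq_card sub) _.
apply: leq_ltn_trans (leq_card_setU _ _) _.
have [Z1|Z1] := eqVneq (Z :\ v) set0.
  rewrite cZ Z1 cards0 (_ : [set e in _ | _] = set0) ?cards0; last first.
    apply/setP=> e; rewrite !inE subset0; case: eqP => [->|]; rewrite ?andbF // andbT.
    by apply/negP=> /edgeP[_]; rewrite cards0.
  rewrite (_ : nbr H v :&: Z = set0) ?imset0 ?cards0 //.
  apply/setP=> y; rewrite !inE; apply/negP=> /andP[vy yZ].
  have : y \in Z :\ v by rewrite !inE yZ eq_sym (adj_neq _ _ _ vy).
  by rewrite Z1 inE.
have ltZ : #|Z :\ v| < k by rewrite cZ in Zk; exact: Zk.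
have colP' : {in Z :\ v &, forall x y, adj H x y -> col x != col y}.
  by move=> x y /setD1P[_ xZ] /setD1P[_ yZ]; apply: colP.
have := IHk _ ltZ colP' Z1; rewrite cZ.
have := leq_trans (leq_imset_card (fun y => [set v; y]) (mem (nbr H v :&: Z))) degv.
move: #|_| #|_| #|_| => x y z; lia.
Qed.

(** * The Turán graph and the extremal example *)

Section Turan.
Variable n : nat.

Definition residue (r : nat) : {set 'I_n} := [set i : 'I_n | i %% 3 == r].

Lemma card_residue r : r < 3 -> #|residue r| = (n + 2 - r) %/ 3.
Proof.
move=> r3; rewrite -sum1_card big_mkcond /=.
under eq_bigr do rewrite inE.
elim: n => [|p IHp]; first by rewrite big_ord0; lia.
rewrite big_ord_recr /= IHp; case: eqP; lia.
Qed.

Lemma adj_turan (i j : 'I_n) : adj (turan 3 n) i j = (i != j %[mod 3]).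
Proof.
apply/imset2P/idP => [[x y _]|ij]; last by exists i j; rewrite ?inE.
rewrite inE => /andP[_ xy] E.
apply: contraNN xy => /eqP ij.
have R z : z \in [set x; y] -> z %% 3 = i %% 3.
  by rewrite -E !inE => /orP[]/eqP->.
by rewrite !R ?set21 ?set22.
Qed.

(** Each vertex is adjacent to all vertices outside its part; the degrees are summed. *)
Lemma turan_card :
  2 * t 3 n + ((n + 2) %/ 3) ^ 2 + ((n + 1) %/ 3) ^ 2 + (n %/ 3) ^ 2 = n ^ 2.
Proof.
have r0 := card_residue 0 isT; have r1 := card_residue 1 isT; have r2 := card_residue 2 isT.
rewrite subn0 in r0; rewrite -addnBA //= in r1; rewrite addnK in r2.
have nbrE (i : 'I_n) : #|nbr (turan 3 n) i| + #|residue (i %% 3)| = n.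
  rewrite -[RHS]card_ord -(cardC (mem (residue (i %% 3)))) addnC; congr (_ + _).
  by apply: eq_card => j; rewrite !inE adj_turan eq_sym.
have sumE : \sum_(i : 'I_n) #|residue (i %% 3)| =
    #|residue 0| ^ 2 + #|residue 1| ^ 2 + #|residue 2| ^ 2.
  rewrite (eq_bigr (fun i : 'I_n => (i \in residue 0) * #|residue 0| +
    (i \in residue 1) * #|residue 1| + (i \in residue 2) * #|residue 2|)).
    rewrite !big_split /= -!big_distrl /=.
    have E r : \sum_(i < n) (i \in residue r) = #|residue r|.
      by rewrite -sum1_card [RHS]big_mkcond.
    by rewrite !E.
  move=> i _; rewrite !inE; have : i %% 3 < 3 by rewrite ltn_mod.
  by case: (i %% 3) => [|[|[|]]] //= _; rewrite !mul1n !addn0.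
rewrite -addnA -addnA [X in _ + X]addnA -r0 -r1 -r2 -sumE -handshake.
rewrite (eq_bigl xpredT) => [|i]; last by rewrite inE.
rewrite -big_split /= (eq_bigr _ (fun i _ => nbrE i)).
by rewrite sum_nat_const card_ord.
Qed.

End Turan.

Lemma turan_plus_edge n : 3 < n ->
  exists G : graph 'I_n, [/\ #|vset G| = n, #|eset G| = t 3 n + 1
    & forall H, subgraph H G -> chordal H -> #|eset H| <= 3 * n - (n + 2) %/ 3 - 4].
Proof.
case: n => [|[|[|[|p]]]] // _; set n := p.+4.
(* Vertices 0 and 3 lie in residue class 0, a largest part; vertex 1 only witnesses that [Z 0] is
   nonempty. *)
pose x0 : 'I_n := inord 0; pose x1 : 'I_n := inord 1; pose x3 : 'I_n := inord 3.
have [v0 v1 v3] : [/\ x0 = 0 :> nat, x1 = 1 :> nat & x3 = 3 :> nat].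
  by split; rewrite inordK.
have n03 : x0 != x3 by rewrite -val_eqE /= v0 v3.
pose E := [set x0; x3] |: eset (turan 3 n).
have EP e : e \in E -> e \subset [set: 'I_n] /\ #|e| = 2.
  case/setU1P=> [->|/edgeP//]; split; first exact: subsetT.
  by rewrite cards2 n03.
pose G := Graph EP.
have adjG x y : adj G x y = ([set x; y] == [set x0; x3]) || (x != y %[mod 3]).
  by rewrite /adj in_setU1 -adj_turan.
exists G; split; first by rewrite cardsT card_ord.
  rewrite cardsU1 addnC -[_ \notin _]/(~~ adj (turan 3 n) x0 x3).
  by rewrite adj_turan v0 v3.
move=> H [_ HG] chH.
have adjH x y : adj H x y -> adj G x y by apply: (subsetP HG).
pose Z r := ~: (x0 |: residue n r).
pose F r := [set e in eset H | e \subset Z r].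
have cF r : r < 3 -> #|F r| < #|Z r|.
  (* Without [x0] the extra edge is gone, and the colour separates the two parts left in [Z r]. *)
  move=> r3; apply: (chordal_bipartite_card H (fun x => x %% 3 == r.+1 %% 3)) => //.
    move=> x y; rewrite !inE !negb_or => /andP[x0' xr] /andP[y0' yr] /adjH.
    rewrite adjG => /orP[/eqP/setP/(_ x0)|xy].
      by rewrite !inE eqxx ![x0 == _]eq_sym (negPf x0') (negPf y0').
    lia.
  apply/set0Pn; have [r0|r0] := eqVneq r 0; [exists x1|exists x3].
    by rewrite !inE -val_eqE /= v0 v1 r0.
  by rewrite !inE -val_eqE /= v0 v3 negb_or /= eq_sym.
(* For [r = 0] the vertex [x0] already belongs to the removed part. *)
have cZ r : #|Z r| + (r != 0) + #|residue n r| = n.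
  rewrite -[RHS]card_ord -(cardsC (x0 |: residue n r)) cardsU1 inE v0 mod0n eq_sym.
  by rewrite -addnA addnC.
have cE0 : #|[set e in eset H | x0 \in e]| + #|residue n 0| <= n + 1.
  rewrite -card_nbr; apply: (@leq_trans (#|x3 |: ~: residue n 0| + #|residue n 0|)).
    rewrite leq_add2r subset_leq_card //; apply/subsetP=> x; rewrite !inE => /adjH.
    rewrite adjG v0 mod0n => /orP[/eqP/setP/(_ x3)|]; last first.
      by rewrite eq_sym => ->; rewrite orbT.
    by rewrite !inE eqxx orbT eq_sym (negPf n03) eq_sym => /= ->.
  have := cardsC (residue n 0); rewrite card_ord cardsU1 => nE.
  by rewrite -addnA (addnC #|~: _|) nE addnC leq_add2l leq_b1.
(* An edge avoiding [x0] joins two parts, hence avoids the third. Each vertex other than [x0] lies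
   in two of the [Z r], so the three forests have at most 2(n - 1) - 3 edges in all. *)
have cover : eset H \subset [set e in eset H | x0 \in e] :|: F 0 :|: F 1 :|: F 2.
  apply/subsetP=> e eH; rewrite !inE eH /=.
  have [//|x0e] := boolP (x0 \in e).
  have [_ /eqP/cards2P[x [y [xy eE]]]] := edgeP eH.
  have : adj G x y by apply: adjH; rewrite /adj -eE.
  rewrite adjG -eE => /orP[/eqP e03|xy3]; first by rewrite e03 set21 in x0e.
  have xx0 : x != x0 by apply: contraNneq x0e => <-; rewrite eE set21.
  have yx0 : y != x0 by apply: contraNneq x0e => <-; rewrite eE set22.
  rewrite eE !subUset !sub1set !inE !negb_or xx0 yx0 /=; lia.
have := leq_trans (subset_leq_card cover) (leq_card_setU _ _).
have := leq_of_leqif (leq_card_setU ([set e in eset H | x0 \in e] :|: F 0) (F 1)).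
have := leq_of_leqif (leq_card_setU [set e in eset H | x0 \in e] (F 0)).
have := cF 0 isT; have := cF 1 isT; have := cF 2 isT.
have := cZ 0; have := cZ 1; have := cZ 2.
have := card_residue n 0 isT; have := card_residue n 1 isT; have := card_residue n 2 isT.
move: cE0; rewrite /=.
move: #|_| #|_| #|_| #|_| #|_| #|_| #|_| #|_| #|_| #|_| #|_| #|_| #|_|; clear; lia.
Qed.

(** [3 * t 3 n] is [n ^ 2] if 3 divides [n], and [n ^ 2 - 1] otherwise. *)
Lemma lt_sqr_turan n : n ^ 2 < 3 * (t 3 n + 1).
Proof.
have := turan_card n; move: (t 3 n) => u.
have [k [r [r3 ->]]] : exists k r, r < 3 /\ n = 3 * k + r.
  by exists (n %/ 3), (n %% 3); lia.
have -> : (3 * k + r + 2) %/ 3 = k + (0 < r) by lia.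
have -> : (3 * k + r + 1) %/ 3 = k + (1 < r) by lia.
have -> : (3 * k + r) %/ 3 = k by lia.
by case: r r3 => [|[|[|]]] //= _; rewrite -!mulnn; nia.
Qed.

Theorem theorem1p2 (n : nat) :
  t 3 n + 1 <= 'C(n, 2) ->
  ((f n (t 3 n + 1))%:Z = 3 * n%:Z - Num.ceil (n%:Q / 3 : rat) - 4)%R.
Proof.
move=> tn; have tc := turan_card n.
(* For [n <= 3] the Turán graph is complete and has no room for another edge. *)
have n3 : 3 < n.
  move: tn tc; rewrite bin2 -!mulnn.
  by case: n => [|[|[|[|p]]]] //; move: (t 3 _) => u; nia.
have -> : Num.ceil (n%:Q / 3 : rat)%R = ((n + 2) %/ 3)%:Z%R.
  apply: ceil_def.
  rewrite ltr_pdivlMr // ler_pdivrMr // (_ : 3%R = 3%:~R :> rat)%R // -!intrM.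
  rewrite ltr_int ler_int; lia.
(* The truncated subtractions are exact because [3 < n]. *)
pose F := 3 * n - (n + 2) %/ 3 - 4.
have -> : f n (t 3 n + 1) = F.
  have [gf fmax] := f_maximum tn.
  apply/eqP; rewrite eqn_leq; apply/andP; split.
    have [G [nG mG upG]] := turan_plus_edge n n3.
    have [H [HG chH fH]] := gf _ G nG mG.
    exact: leq_trans fH (upG H HG chH).
  apply: fmax => T G nG mG.
  have [H [HG chH FH]] : exists H, [/\ subgraph H G, chordal H
      & (3 * (#|vset G|)%:Z - ((n + 2) %/ 3)%:Z - 4 <= #|eset H|%:Z)%R].
    apply: (chordal_lower G (n %/ 3)%:Z (n %% 3)%:Z); rewrite ?nG ?mG; [lia|lia|].
    by have := lt_sqr_turan n; rewrite -!mulnn; lia.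
  exists H; split=> //; rewrite nG in FH; rewrite /F; lia.
rewrite /F; lia.
Qed.
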